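(* Let $N$ be a simply connected two-step nilpotent Lie group of dimension five whose Lie algebra has two-dimensional center. Then there is no left invariant Randers metric of Berwald type on $N$; that is, for no left invariant Riemannian metric $g$ on $N$ and no nonzero vector field $X$ on $N$ with $\sqrt{g(X,X)}<1$ everywhere is the Randers metric $F(x,Y)=\sqrt{g(x)(Y,Y)}+g(x)(X(x),Y)$ both left invariant and of Berwald type.
   Context: A Lie group is two-step nilpotent if its Lie algebra $\mathfrak{n}$ is non-abelian and $[\mathfrak{n},[\mathfrak{n},\mathfrak{n}]]=0$. For a Riemannian metric $g$ and a vector field $X$ on a manifold $M$ with $\sqrt{g(X,X)}<1$, the Randers metric defined by $g$ and $X$ is the Finsler metric $F(x,Y)=\sqrt{g(x)(Y,Y)}+g(x)(X(x),Y)$ for $x\in M$, $Y\in T_xM$. Such an $F$ is of Berwald type if and only if $X$ is parallel with respect to the Levi-Civita connection of $g$; this may be taken as the definition. A Finsler metric $F$ on a Lie group $G$ with unit element $e$ is left invariant if $F(a,Y)=F(e,T_a l_{a^{-1}}Y)$ for all $a\in G$, $Y\in T_aG$, where $l_{a^{-1}}$ is left translation by $a^{-1}$. A left invariant Riemannian metric is one for which all left translations are isometries. *)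

(* Defs.v *)
From HB Require Import structures.
From mathcomp Require Import all_boot all_order all_algebra.
From mathcomp Require Import all_classical all_reals all_analysis.

Set Implicit Arguments.
Unset Strict Implicit.
Unset Printing Implicit Defensive.

Import Order.TTheory GRing.Theory Num.Theory.
Import numFieldNormedType.Exports.

Local Open Scope classical_set_scope.
Local Open Scope ring_scope.

Section SmoothCalculus.
Context {R : realType} {V W : normedModType R}.

(* V is finite-dimensional in every use, where "C^(k+1) iff differentiable
   with all directional derivatives C^k" is the usual notion. *)
Fixpoint Ck_on (k : nat) (U : set V) (f : V -> W) : Prop :=
  if k is k'.+1 then
    (forall x, U x -> differentiable f x) /\
    (forall v, Ck_on k' U (fun x => 'd f x v))
  else forall x, U x -> {for x, continuous f}.

Definition smooth_on (U : set V) (f : V -> W) : Prop :=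
  forall k, Ck_on k U f.

Definition smooth_near (x : V) (f : V -> W) : Prop :=
  exists2 U, open_nbhs x U & smooth_on U f.

End SmoothCalculus.

(* [chart_fun] and [chart_inv] are total functions; only their values on
   [chart_dom] and on the image of [chart_dom] are meaningful. *)
Record chart (E M : Type) := Chart {
  chart_dom : set M;
  chart_fun : M -> E;
  chart_inv : E -> M
}.

Definition chart_img (E M : Type) (c : chart E M) : set E :=
  chart_fun c @` chart_dom c.

Definition is_chart (E M : topologicalType) (c : chart E M) : Prop :=
  [/\ open (chart_dom c),
      open (chart_img c),
      forall x, chart_dom c x -> chart_inv c (chart_fun c x) = x,
      forall x, chart_dom c x -> {for x, continuous (chart_fun c)} &
      forall u, chart_img c u -> {for u, continuous (chart_inv c)}].

Definition smooth_transition (R : realType) (E : normedModType R) (M : Type)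
    (c d : chart E M) : Prop :=
  smooth_on (chart_fun c @` (chart_dom c `&` chart_dom d))
            (chart_fun d \o chart_inv c).

HB.mixin Record isManifold (R : realType) (n : nat) (M : Type)
    of Topological M := {
  atlas : set (chart 'rV[R]_n M);
  manifold_hausdorff : hausdorff_space M;
  manifold_second_countable : @second_countable M;
  atlas_chart : forall c, atlas c -> is_chart c;
  atlas_cover : forall x : M, exists2 c, atlas c & chart_dom c x;
  atlas_compatible : forall c d, atlas c -> atlas d -> smooth_transition c d
}.

#[short(type="manifoldType")]
HB.structure Definition Manifold (R : realType) (n : nat) :=
  { M of isManifold R n M & Topological M }.

Definition smooth_map_at (R : realType) (E F : normedModType R)
    (M N : topologicalType) (A : set (chart E M)) (B : set (chart F N))
    (f : M -> N) (x : M) : Prop :=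
  {for x, continuous f} /\
  exists c d, [/\ A c, B d, chart_dom c x, chart_dom d (f x) &
    smooth_near (chart_fun c x) (chart_fun d \o f \o chart_inv c)].

Definition prod_chart (E F M N : Type) (c : chart E M) (d : chart F N) :
    chart (E * F) (M * N) :=
  Chart (chart_dom c `*` chart_dom d)
        (fun p => (chart_fun c p.1, chart_fun d p.2))
        (fun q => (chart_inv c q.1, chart_inv d q.2)).

Definition prod_atlas (E F M N : Type) (A : set (chart E M))
    (B : set (chart F N)) : set (chart (E * F) (M * N)) :=
  [set prod_chart c d | c in A & d in B].

HB.mixin Record isLieGroup (R : realType) (n : nat) (G : Type)
    of Manifold R n G & Group G := {
  lie_mul_smooth : forall p : G * G,
    smooth_map_at (prod_atlas (@atlas R n G) (@atlas R n G)) (@atlas R n G)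
      (fun q : G * G => (q.1 * q.2)%g) p;
  lie_inv_smooth : forall x : G,
    smooth_map_at (@atlas R n G) (@atlas R n G) (fun y : G => (y^-1)%g) x
}.

#[short(type="lieGroupType")]
HB.structure Definition LieGroup (R : realType) (n : nat) :=
  { G of isLieGroup R n G & Manifold R n G & Group G }.

Definition simply_connected (R : realType) (M : topologicalType) : Prop :=
  (forall x y : M, exists p : R -> M,
     [/\ {within `[0, 1], continuous p}, p 0 = x & p 1 = y]) /\
  (forall p : R -> M, {within `[0, 1], continuous p} -> p 0 = p 1 ->
   exists H : R * R -> M,
     [/\ {within `[0, 1]%classic `*` `[0, 1]%classic, continuous H},
         forall t, 0 <= t <= 1 -> H (t, 0) = p t,
         forall t, 0 <= t <= 1 -> H (t, 1) = p 0,
         forall s, 0 <= s <= 1 -> H (0, s) = p 0 &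
         forall s, 0 <= s <= 1 -> H (1, s) = p 0]).

(* [b] is a basis of the subspace [S]. *)
Definition is_basis (R : realType) (V : lmodType R) (S : set V) (k : nat)
    (b : 'I_k -> V) : Prop :=
  (forall v, S v <-> exists c : 'I_k -> R, v = \sum_(i < k) c i *: b i) /\
  (forall c : 'I_k -> R,
     \sum_(i < k) c i *: b i = 0 -> forall i, c i = 0).

Definition has_dimension (R : realType) (V : lmodType R) (S : set V)
    (k : nat) : Prop :=
  exists b : 'I_k -> V, is_basis S b.

Section Manifolds.
Context {R : realType} {n : nat} {M : manifoldType R n}.

Local Notation tvec := ((M -> R) -> R).
Local Notation vfield := (M -> (M -> R) -> R).

Definition smooth_at (x : M) (f : M -> R) : Prop :=
  exists c, [/\ atlas c, chart_dom c x &
    smooth_near (chart_fun c x) (f \o chart_inv c)].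

Definition smooth_fun (f : M -> R) : Prop := forall x, smooth_at x f.

(* A tangent vector at x is the operator sending a function smooth near x to
   its directional derivative at x, computed in a chart. Operators are given
   the value 0 on functions not smooth near x, so that each tangent vector is
   one function and T_x M is a subspace of tvec. *)
Definition tangent (x : M) (v : tvec) : Prop :=
  exists c w, [/\ atlas c, chart_dom c x & forall f : M -> R,
    v f = if `[< smooth_at x f >]
          then 'D_w (f \o chart_inv c) (chart_fun c x) else 0].

Definition vector_field (X : vfield) : Prop :=
  (forall x, tangent x (X x)) /\
  (forall x f, smooth_at x f -> smooth_at x (fun y => X y f)).

Definition lie_bracket (X Y : vfield) : vfield :=
  fun x f => if `[< smooth_at x f >]
    then X x (fun y => Y y f) - Y x (fun y => X y f) else 0.

Record riemannian_metric (g : M -> tvec -> tvec -> R) : Prop := {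
  metric_linear : forall x (a : R) u v w,
    tangent x u -> tangent x v -> tangent x w ->
    g x (a *: u + v) w = a * g x u w + g x v w;
  metric_sym : forall x u v, tangent x u -> tangent x v ->
    g x u v = g x v u;
  metric_pos : forall x u, tangent x u -> u <> 0 -> 0 < g x u u;
  metric_smooth : forall X Y, vector_field X -> vector_field Y ->
    smooth_fun (fun x => g x (X x) (Y x))
}.

(* [nabla X Y] is the covariant derivative of Y along X. *)
Record levi_civita (g : M -> tvec -> tvec -> R)
    (nabla : vfield -> vfield -> vfield) : Prop := {
  connection_field : forall X Y, vector_field X -> vector_field Y ->
    vector_field (nabla X Y);
  connection_linear : forall phi X Y Z, smooth_fun phi ->
    vector_field X -> vector_field Y -> vector_field Z ->
    nabla (fun x => phi x *: X x + Y x) Z =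
    (fun x => phi x *: nabla X Z x + nabla Y Z x);
  connection_add : forall X Y Z,
    vector_field X -> vector_field Y -> vector_field Z ->
    nabla X (Y + Z) = nabla X Y + nabla X Z;
  connection_leibniz : forall phi X Y, smooth_fun phi ->
    vector_field X -> vector_field Y ->
    nabla X (fun x => phi x *: Y x) =
    (fun x => X x phi *: Y x + phi x *: nabla X Y x);
  connection_metric : forall X Y Z,
    vector_field X -> vector_field Y -> vector_field Z ->
    forall x, X x (fun y => g y (Y y) (Z y)) =
      g x (nabla X Y x) (Z x) + g x (Y x) (nabla X Z x);
  connection_torsion_free : forall X Y, vector_field X -> vector_field Y ->
    nabla X Y - nabla Y X = lie_bracket X Y
}.

(* By the fundamental theorem of Riemannian geometry exactly one connection on
   smooth vector fields satisfies [levi_civita g]. *)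
Definition parallel (g : M -> tvec -> tvec -> R) (X : vfield) : Prop :=
  exists2 nabla, levi_civita g nabla &
    forall Y, vector_field Y -> nabla Y X = 0.

Definition randers (g : M -> tvec -> tvec -> R) (X : vfield) : M -> tvec -> R :=
  fun x Y => Num.sqrt (g x Y Y) + g x (X x) Y.

(* A Randers metric is of Berwald type when its vector field is parallel for
   the Levi-Civita connection of its Riemannian metric; this is taken as the
   definition. *)
Definition randers_berwald (g : M -> tvec -> tvec -> R) (X : vfield) : Prop :=
  parallel g X.

End Manifolds.

Section LieGroups.
Context {R : realType} {n : nat} {G : lieGroupType R n}.

Local Notation tvec := ((G -> R) -> R).
Local Notation vfield := (G -> (G -> R) -> R).

(* The differential of the left translation by [a], from T_x G to T_(a x) G. *)
Definition left_diff (a : G) (v : tvec) : tvec :=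
  fun f => v (fun y => f (a * y)%g).

Definition lie_algebra : set vfield :=
  [set X | vector_field X /\
           forall a x : G, X (a * x)%g = left_diff a (X x)].

Definition lie_center : set vfield :=
  [set X | lie_algebra X /\ forall Y, lie_algebra Y -> lie_bracket X Y = 0].

Definition two_step_nilpotent : Prop :=
  (exists X Y, [/\ lie_algebra X, lie_algebra Y & lie_bracket X Y <> 0]) /\
  (forall X Y Z, lie_algebra X -> lie_algebra Y -> lie_algebra Z ->
     lie_bracket X (lie_bracket Y Z) = 0).

Definition left_invariant_metric (g : G -> tvec -> tvec -> R) : Prop :=
  forall (a x : G) u v, tangent x u -> tangent x v ->
    g (a * x)%g (left_diff a u) (left_diff a v) = g x u v.

Definition left_invariant_finsler (F : G -> tvec -> R) : Prop :=
  forall (a : G) Y, tangent a Y -> F a Y = F 1%g (left_diff a^-1%g Y).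

End LieGroups.

Arguments lie_algebra {R n} G.
Arguments lie_center {R n} G.
Arguments two_step_nilpotent {R n} G.

(* Main.v *)
From HB Require Import structures.
Require Import Defs.
From mathcomp Require Import all_boot all_order all_algebra.
From mathcomp Require Import all_classical all_reals all_analysis.
From mathcomp Require Import ring.
Import Order.TTheory GRing.Theory Num.Theory.
Import numFieldNormedType.Exports.
Local Open Scope classical_set_scope.
Local Open Scope ring_scope.
Set Implicit Arguments.
Unset Strict Implicit.
Unset Printing Implicit Defensive.

(** Write [n] for the Lie algebra, [z] for its two-dimensional center and
    [<,>] for the inner product on [n] given by the metric at the identity.
    Suppose that a Berwald metric of the forbidden kind exists.

    The odd part of [F] in [Y] is [g(X, Y)], so left invariance of [F] forces
    [X] to be left invariant ([left_invariant_randers_field]).  On left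
    invariant fields the functions [g(Y, Z)] are constant, so compatibility of
    the connection with [g] says that each [nabla_Y] is skew-adjoint.  Since
    [nabla_Y X = 0], this gives [<nabla_Y Z, X> = 0], and torsion-freeness
    turns it into [<[Y, Z], X> = 0]: the field [X] is orthogonal to [[n, n]]
    ([parallel_bracket_orthogonal]).  It also gives [nabla_X = ad X], so [ad X]
    is skew-adjoint; as [(ad X)^2 = 0] by two-step nilpotency,
    [|[X, Y]|^2 = - <Y, [X, [X, Y]]> = 0] and [X] is central
    ([parallel_central]).

    So [[n, n]] lies in the line of [z] orthogonal to [X].  Let [W] span that
    line ([orthogonal_in_center]); then [(Y, Z) |-> <[Y, Z], W>] is an
    alternating form whose radical is exactly [z], hence nondegenerate on
    [n / z].  But [n / z] has odd dimension [5 - 2 = 3], where every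
    alternating form is degenerate.  Instead of passing to the quotient, the
    argument adds to this form the area form of the plane [z] ([bracket_form]).
    The sum is alternating on the five-dimensional space [n], so some [V <> 0]
    is in its radical ([odd_skew_degenerate]).  Pairing [V] with [W] and with
    [X] shows that [V] is orthogonal to [z]; pairing it with all fields then
    shows [[V, Z] = 0] for all [Z], so [V] lies in [z] as well, and [V = 0].

    The differential geometry behind this is the identification of [n] with
    the tangent space at the identity, of dimension exactly five
    ([lie_algebra_coordinates]).  It needs that tangent spaces are
    parametrized by the components in any chart ([tangentP],
    [chart_tangent_inj]) and that the left translates of a tangent vector form
    a smooth field ([left_field_vector_field]); both rest on the chain rule
    for maps of class C^k ([Ck_on_comp]). *)

(** * Maps of class C^k *)

Section Calculus.
Context {R : realType}.

(** The definition of ['d f x] is a choice that mentions all of [f]; uniqueness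
    of the differential shows that only the germ of [f] at [x] matters. *)
Lemma near_eq_differentiable (V W : normedModType R) (f g : V -> W) (x : V) :
  (\forall y \near x, f y = g y) -> differentiable f x ->
  differentiable g x /\ 'd g x = 'd f x :> (V -> W).
Proof.
move=> fg df.
have dfc : continuous ('d f x) by apply: diff_continuous.
have dgE : g \o shift x = cst (g x) + 'd f x +o_ 0 id.
  apply/eqaddoP => e e0; rewrite -(nbhs_singleton fg).
  have /eqaddoP/(_ e e0) := diff_locally df.
  apply: filter_app; have := fg; rewrite (near_shift 0 x) subr0.
  by apply: filterS => y /= fgy; rewrite !fctE /= -fgy.
have dE := diff_unique dfc dgE.
split; last exact: dE.
pose P (d : V -> W) := continuous d /\ g \o shift x = cst (g x) + d +o_ 0 id.
have Pf : P ('d f x) by split.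
exact/diff_locallyP/(eq_ind_r P Pf dE).
Qed.

Lemma near_open (V : topologicalType) (U : set V) (x : V) (P : V -> Prop) :
  open U -> U x -> (forall y, U y -> P y) -> \forall y \near x, P y.
Proof. by move=> oU Ux UP; apply: filterS UP _; apply: open_nbhs_nbhs. Qed.

Lemma Ck_on_sub (V W : normedModType R) k (U U' : set V) (f : V -> W) :
  U' `<=` U -> Ck_on k U f -> Ck_on k U' f.
Proof.
move=> UU'; elim: k f => [|k IH] f /=; first by move=> fU x /UU' /fU.
by move=> [fd fU]; split=> [x /UU' /fd//|v]; apply: IH.
Qed.

(** On an open set only: differentiability at a point of [U] looks at a whole
    neighbourhood, on which [f] and [g] must agree. *)
Lemma eq_Ck_on (V W : normedModType R) k (U : set V) (f g : V -> W) :
  open U -> (forall x, U x -> f x = g x) -> Ck_on k U f -> Ck_on k U g.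
Proof.
move=> oU; elim: k f g => [|k IH] f g fg /=.
  move=> fU x Ux; rewrite /prop_for /continuous_at -(fg x Ux).
  apply: cvg_trans (fU x Ux); apply: near_eq_cvg.
  exact: near_open Ux _.
move=> [fd fU].
have E x (Ux : U x) := near_eq_differentiable (near_open oU Ux fg) (fd x Ux).
split=> [x /E[]//|v]; apply: IH (fU v) => x /E[_ ->//].
Qed.

Lemma Ck_onW (V W : normedModType R) k (U : set V) (f : V -> W) :
  Ck_on k.+1 U f -> Ck_on k U f.
Proof.
elim: k f => [|k IH] f [fd fU].
  by move=> x Ux; apply/differentiable_continuous/fd.
by split=> // v; apply: IH.
Qed.

Lemma Ck_on_cst (V W : normedModType R) k (U : set V) (c : W) :
  Ck_on k U (fun _ : V => c).
Proof.
elim: k c => [|k IH] c /=; first by move=> x _; apply: cst_continuous.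
split=> [x _|v]; first exact: differentiable_cst.
by rewrite (_ : (fun _ => _) = fun=> 0) // funeqE => x; rewrite diff_cst.
Qed.

Lemma Ck_on_linear (V W : normedModType R) k (U : set V) (L : {linear V -> W}) :
  continuous L -> Ck_on k U L.
Proof.
move=> cL; case: k => [|k] /=; first by move=> x _; apply: cL.
split=> [x _|v]; first exact: linear_differentiable.
rewrite (_ : (fun _ => _) = fun=> L v); first exact: Ck_on_cst.
by rewrite funeqE => x; rewrite diff_lin.
Qed.

Lemma Ck_onD (V W : normedModType R) k (U : set V) (f g : V -> W) :
  open U -> Ck_on k U f -> Ck_on k U g -> Ck_on k U (fun x => f x + g x).
Proof.
move=> oU; elim: k f g => [|k IH] f g /=.
  by move=> fU gU x Ux; apply: cvgD; [apply: fU|apply: gU].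
move=> [fd fU] [gd gU]; split=> [x Ux|v].
  by apply: differentiableD; [apply: fd|apply: gd].
apply: eq_Ck_on (IH _ _ (fU v) (gU v)) => // x Ux.
exact/esym/(congr1 (fun h : V -> W => h v) (diffD (fd x Ux) (gd x Ux))).
Qed.

Lemma Ck_on_sum (V W : normedModType R) k (U : set V) (I : Type) (r : seq I)
    (f : I -> V -> W) :
  open U -> (forall i, Ck_on k U (f i)) ->
  Ck_on k U (fun x => \sum_(i <- r) f i x).
Proof.
move=> oU fU; elim: r => [|i r IH].
  apply: eq_Ck_on (Ck_on_cst k U 0) => // x _; by rewrite big_nil.
apply: eq_Ck_on (Ck_onD oU (fU i) IH) => // x _; by rewrite big_cons.
Qed.

Lemma Ck_on_linear_comp (V W Z : normedModType R) k (U : set V) (f : V -> W)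
    (L : {linear W -> Z}) :
  open U -> continuous L -> Ck_on k U f -> Ck_on k U (fun x => L (f x)).
Proof.
move=> oU cL; elim: k f => [|k IH] f /=.
  by move=> fU x Ux; apply: continuous_comp; [apply: fU|apply: cL].
move=> [fd fU]; have Ld y : differentiable L y by apply: linear_differentiable.
split=> [x Ux|v].
  by apply: (@differentiable_comp _ _ _ _ f L); [apply: fd|].
apply: eq_Ck_on (IH _ (fU v)) => // x Ux.
by rewrite (@diff_comp _ _ _ _ f L) //; [rewrite /= diff_lin|apply: fd].
Qed.

Lemma scaler_is_bilinear (W : normedModType R) :
  bilinear_for (GRing.Scale.Law.clone _ _ *:%R _)
    (GRing.Scale.Law.clone _ _ *:%R _) (fun (a : R) (w : W) => a *: w).
Proof.
split=> [u'|u] a x y /=; first by rewrite scalerDl scalerA.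
by rewrite scalerDr !scalerA mulrC.
Qed.

(** Product rule, read off from the differential of the bilinear map
    [(a, w) |-> a *: w]. *)
Lemma is_diff_scale (V W : normedModType R) (a : V -> R) (f : V -> W) x :
  differentiable a x -> differentiable f x ->
  differentiable (fun y => a y *: f y) x /\
  forall v, 'd (fun y => a y *: f y) x v = 'd a x v *: f x + a x *: 'd f x v.
Proof.
move=> da df.
pose bM := bilinear_isBilinear.Build R R W W _ _ _ (scaler_is_bilinear W).
pose b : {bilinear R -> W -> W} := HB.pack (fun (a : R) (w : W) => a *: w) bM.
have bc : continuous (fun p : R * W => b p.1 p.2).
  by move=> p; apply: scale_continuous.
have dp : differentiable (fun y => (a y, f y)) x by apply: differentiable_pair.
have db := differentiable_bilin (a x, f x) bc.
split; first exact: (differentiable_comp dp db).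
move=> v; have -> := congr1 (fun h : V -> W => h v) (diff_comp dp db).
have /= -> := congr1 (fun h : R * W -> W => h ('d (fun y => (a y, f y)) x v))
  (diff_bilin (a x, f x) bc).
have -> := congr1 (fun h : V -> R * W => h v) (diff_pair da df).
by rewrite /= addrC.
Qed.

Lemma Ck_on_scale (V W : normedModType R) k (U : set V) (a : V -> R)
    (f : V -> W) :
  open U -> Ck_on k U a -> Ck_on k U f -> Ck_on k U (fun x => a x *: f x).
Proof.
move=> oU; elim: k a f => [|k IH] a f.
  by move=> aU fU x Ux; apply: cvgZ; [apply: aU|apply: fU].
move=> aU fU; have [aU' fU'] := (Ck_onW aU, Ck_onW fU).
move: aU fU => [ad aU] [fd fU].
split=> [x Ux|v]; first by case: (is_diff_scale (ad x Ux) (fd x Ux)).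
apply: eq_Ck_on (Ck_onD oU (IH _ _ (aU v) fU') (IH _ _ aU' (fU v))) => // x Ux.
by have [_ ->] := is_diff_scale (ad x Ux) (fd x Ux).
Qed.

(** Finite dimension in the form that the chain rule consumes: continuous
    coordinate functionals together with the vectors that they expand along. *)
Definition finite_coords (W : normedModType R) :=
  exists (I : finType) (l : I -> {linear W -> R}) (e : I -> W),
    (forall i, continuous (l i)) /\ forall w, w = \sum_i l i w *: e i.

(** The class C^k is defined through one directional derivative at a time,
    whereas the derivative of [f \o g] along [v] is ['d f (g x)] evaluated at a
    vector depending on [x].  Expanding that vector in coordinates of [W] writes
    it as a finite sum of products of maps covered by the induction. *)
Lemma Ck_on_comp (V W Z : normedModType R) k (U : set V) (O : set W)
    (g : V -> W) (f : W -> Z) :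
  finite_coords W -> open U -> (forall x, U x -> O (g x)) ->
  Ck_on k U g -> Ck_on k O f -> Ck_on k U (f \o g).
Proof.
move=> [I [l [e [lc le]]]] oU UO; elim: k f => [|k IH] f.
  by move=> gU fO x Ux; apply: continuous_comp; [apply: gU|apply/fO/UO].
move=> gU fO; have gU' := Ck_onW gU; move: gU fO => [gd gU] [fd fO].
split=> [x Ux|v].
  by apply: differentiable_comp; [apply: gd|apply/fd/UO].
have S : Ck_on k U (fun x => \sum_i l i ('d g x v) *: 'd f (g x) (e i)).
  apply: Ck_on_sum => // i; apply: Ck_on_scale => //.
    exact: (Ck_on_linear_comp oU (lc i) (gU v)).
  exact: (IH _ gU' (fO (e i))).
apply: eq_Ck_on S => // x Ux.
rewrite (diff_comp (gd x Ux) (fd _ (UO x Ux))) /= {2}(le ('d g x v)) linear_sum.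
by apply: eq_bigr => i _; rewrite linearZ.
Qed.

Lemma smooth_on_comp (V W Z : normedModType R) (U : set V) (O : set W)
    (g : V -> W) (f : W -> Z) :
  finite_coords W -> open U -> (forall x, U x -> O (g x)) ->
  smooth_on U g -> smooth_on O f -> smooth_on U (f \o g).
Proof. by move=> fW oU UO gU fO k; apply: (Ck_on_comp fW oU UO). Qed.

Lemma coord_linear n (i : 'I_n) :
  exists l : {linear 'rV[R]_n -> R}, continuous l /\ forall w, l w = w 0 i.
Proof.
have lin : linear (fun w : 'rV[R]_n => w 0 i : R).
  by move=> a u v; rewrite !mxE.
pose lM := GRing.isLinear.Build _ _ _ _ _ lin.
pose l : {linear 'rV[R]_n -> R} := HB.pack (fun w : 'rV[R]_n => w 0 i) lM.
by exists l; split=> //; apply: coord_continuous.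
Qed.

Lemma finite_coords_rV n : finite_coords 'rV[R]_n.
Proof.
have [l /all_and2[lc lE]] := choice (@coord_linear n).
exists 'I_n, l, (fun i => delta_mx 0 i); split=> [//|w].
by rewrite {1}(row_sum_delta w); apply: eq_bigr => i _; rewrite lE.
Qed.

Lemma finite_coords_prod (V W : normedModType R) :
  finite_coords V -> finite_coords W -> finite_coords (V * W)%type.
Proof.
move=> [I [l [e [lc le]]]] [J [m [f [mc mf]]]].
have H (i : (I + J)%type) : exists L : {linear (V * W)%type -> R},
    continuous L /\
    forall w, L w = match i with inl i => l i w.1 | inr j => m j w.2 end.
  case: i => i.
    exists (l i \o fst); split=> // x.
    by apply: (@continuous_comp _ _ _ fst (l i)); [exact: cvg_fst|exact: lc].
  exists (m i \o snd); split=> // x.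
  by apply: (@continuous_comp _ _ _ snd (m i)); [exact: cvg_snd|exact: mc].
have [L /all_and2[Lc LE]] := choice H.
exists (I + J)%type, L,
  (fun i => match i with inl i => (e i, 0) | inr j => (0, f j) end).
split=> // w; rewrite big_sumType /=.
under eq_bigr => i _ do rewrite LE.
under [X in _ + X]eq_bigr => i _ do rewrite LE.
case: w => v w /=; apply/pair_equal_spec; split.
  rewrite {1}(le v) !(raddf_sum fst) /= [X in _ + X]big1 ?addr0 //.
  by move=> j _; rewrite scaler0.
rewrite {1}(mf w) !(raddf_sum snd) /= [X in X + _]big1 ?add0r //.
by move=> j _; rewrite scaler0.
Qed.

End Calculus.

(** * Germs of smooth maps *)

Lemma open_setI_preimage (V W : topologicalType) (U : set V) (O : set W)
    (g : V -> W) :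
  open U -> (forall x, U x -> {for x, continuous g}) -> open O ->
  open (U `&` g @^-1` O).
Proof.
move=> oU gc oO; rewrite openE => x [Ux Ox].
apply: filterI; first exact: open_nbhs_nbhs.
by apply: gc => //; apply: open_nbhs_nbhs.
Qed.

Section SmoothNear.
Context {R : realType}.

Lemma smooth_near_differentiable (V W : normedModType R) (x : V) (f : V -> W) :
  smooth_near x f -> differentiable f x.
Proof. by move=> [U [oU Ux] /(_ 1%N)[+ _]]; apply. Qed.

Lemma eq_smooth_near (V W : normedModType R) (x : V) (f g : V -> W) :
  (\forall y \near x, f y = g y) -> smooth_near x f -> smooth_near x g.
Proof.
move=> fg [U Ux fU].
have : nbhs x [set y | f y = g y] := fg; rewrite nbhsE => -[B Bx fgB].
exists (U `&` B); first exact: open_nbhsI.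
move=> k; apply: (@eq_Ck_on _ _ _ _ _ f).
- by apply: openI; [case: Ux|case: Bx].
- by move=> y [_ /fgB].
- by apply: Ck_on_sub (fU k) => y [].
Qed.

Lemma smooth_near_comp (V W Z : normedModType R) (x : V)
    (g : V -> W) (f : W -> Z) :
  finite_coords W -> smooth_near x g -> smooth_near (g x) f ->
  smooth_near x (f \o g).
Proof.
move=> fW [U [oU Ux] gU] [B [oB Bgx] fO].
have oUO : open (U `&` g @^-1` B).
  by apply: open_setI_preimage => //; apply: (gU 0%N).
exists (U `&` g @^-1` B); first by [].
apply: (smooth_on_comp (O := B)) => //; first by move=> y [].
by move=> k; apply: Ck_on_sub (gU k) => y [].
Qed.

Lemma smooth_nearT (V W : normedModType R) (x : V) (f : V -> W) :
  smooth_on setT f -> smooth_near x f.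
Proof. by move=> fT; exists setT => //; apply: open_nbhsT. Qed.

Lemma smooth_on_linear (V W : normedModType R) (U : set V)
  (L : {linear V -> W}) : continuous L -> smooth_on U L.
Proof. by move=> cL k; apply: Ck_on_linear. Qed.

Lemma smooth_on_pairr (V W : normedModType R) (a : V) :
  smooth_on setT (fun w : W => (a, w)).
Proof.
have lin : linear (fun w : W => (0, w) : V * W).
  by move=> c u v; apply/pair_equal_spec; split=> //=; rewrite scaler0 addr0.
pose iM := GRing.isLinear.Build _ _ _ _ _ lin.
pose i : {linear W -> (V * W)%type} := HB.pack (fun w : W => (0, w) : V * W) iM.
have ic : continuous i.
  by move=> w; apply: cvg_pair; [apply: cvg_cst|apply: cvg_id].
move=> k.
have S := Ck_onD openT (Ck_on_cst k setT (a, 0)) (Ck_on_linear k setT ic).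
apply: eq_Ck_on S; first exact: openT.
by move=> w _; apply/pair_equal_spec; split=> /=; rewrite ?addr0 ?add0r.
Qed.

Lemma smooth_on_pairl (V W : normedModType R) (b : W) :
  smooth_on setT (fun v : V => (v, b)).
Proof.
have lin : linear (fun v : V => (v, 0) : V * W).
  by move=> c u v; apply/pair_equal_spec; split=> //=; rewrite scaler0 addr0.
pose iM := GRing.isLinear.Build _ _ _ _ _ lin.
pose i : {linear V -> (V * W)%type} := HB.pack (fun v : V => (v, 0) : V * W) iM.
have ic : continuous i.
  by move=> w; apply: cvg_pair; [apply: cvg_id|apply: cvg_cst].
move=> k.
have S := Ck_onD openT (Ck_on_cst k setT (0, b)) (Ck_on_linear k setT ic).
apply: eq_Ck_on S; first exact: openT.
by move=> w _; apply/pair_equal_spec; split=> /=; rewrite ?addr0 ?add0r.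
Qed.

End SmoothNear.

(** * Tangent vectors in charts *)

Section Charts.
Context {R : realType} {n : nat} {M : manifoldType R n}.
Implicit Types (c d : chart 'rV[R]_n M) (x y : M) (f g : M -> R).

Lemma chart_invK c x : atlas c -> chart_dom c x ->
  chart_inv c (chart_fun c x) = x.
Proof. by move=> /atlas_chart [_ _ + _ _]; apply. Qed.

Lemma chart_img_dom c u : atlas c -> chart_img c u ->
  chart_dom c (chart_inv c u) /\ chart_fun c (chart_inv c u) = u.
Proof. by move=> ac [y cy <-]; rewrite chart_invK. Qed.

Lemma chart_img_fun c x : chart_dom c x -> chart_img c (chart_fun c x).
Proof. by move=> cx; exists x. Qed.

Lemma chart_inv_continuous c x : atlas c -> chart_dom c x ->
  {for chart_fun c x, continuous (chart_inv c)}.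
Proof. by move=> /atlas_chart [_ _ _ _ +] cx; apply; exists x. Qed.

Lemma near_chart_img c x : atlas c -> chart_dom c x ->
  \forall u \near chart_fun c x, chart_img c u.
Proof.
move=> ac cx; apply: open_nbhs_nbhs; split; last exact: chart_img_fun.
by case: (atlas_chart c ac).
Qed.

Lemma near_chart_inv c x (P : M -> Prop) : atlas c -> chart_dom c x ->
  (\forall y \near x, P y) -> \forall u \near chart_fun c x, P (chart_inv c u).
Proof.
by move=> ac cx Px; apply: (chart_inv_continuous ac cx); rewrite chart_invK.
Qed.

Lemma near_chart_dom c x : atlas c -> chart_dom c x ->
  \forall y \near x, chart_dom c y.
Proof.
by move=> ac cx; apply: open_nbhs_nbhs; split => //; case: (atlas_chart c ac).
Qed.

Lemma transition_smooth_near c d x : atlas c -> atlas d -> chart_dom c x ->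
  chart_dom d x -> smooth_near (chart_fun c x) (chart_fun d \o chart_inv c).
Proof.
move=> ac ad cx dx.
exists (chart_fun c @` (chart_dom c `&` chart_dom d)).
  2: exact: atlas_compatible.
split; last by exists x.
have -> : chart_fun c @` (chart_dom c `&` chart_dom d) =
    chart_img c `&` chart_inv c @^-1` chart_dom d.
  apply/seteqP; split=> [_ [y [cy dy] <-]|u [cu du]].
    by split; [exact: chart_img_fun|rewrite /= chart_invK].
  by have [] := chart_img_dom ac cu; exists (chart_inv c u).
have [oc oi _ _ cc] := atlas_chart c ac; have [od _ _ _ _] := atlas_chart d ad.
exact: open_setI_preimage.
Qed.

(** Only a germ equality: outside the image of the overlap, [chart_inv c] may
    leave the domain of [d]. *)
Lemma near_transition (T : Type) c d x (f : M -> T) :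
  atlas c -> atlas d -> chart_dom c x -> chart_dom d x ->
  \forall u \near chart_fun c x,
    ((f \o chart_inv d) \o (chart_fun d \o chart_inv c)) u =
    (f \o chart_inv c) u.
Proof.
move=> ac ad cx dx.
apply: filterS (near_chart_inv ac cx (near_chart_dom ad dx)).
by move=> u du /=; rewrite chart_invK.
Qed.

(** Smoothness at a point can be tested in any chart there, because transition
    maps are smooth. *)
Lemma smooth_near_change (W : normedModType R) c d x (f : M -> W) :
  atlas c -> atlas d -> chart_dom c x -> chart_dom d x ->
  smooth_near (chart_fun d x) (f \o chart_inv d) ->
  smooth_near (chart_fun c x) (f \o chart_inv c).
Proof.
move=> ac ad cx dx fd.
apply: eq_smooth_near (near_transition f ac ad cx dx) _.
apply: smooth_near_comp; first exact: finite_coords_rV.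
  exact: transition_smooth_near.
by rewrite /= chart_invK.
Qed.

Lemma smooth_at_chart c x f : atlas c -> chart_dom c x -> smooth_at x f ->
  smooth_near (chart_fun c x) (f \o chart_inv c).
Proof. by move=> ac cx [d [ad dx fd]]; apply: smooth_near_change fd. Qed.

Lemma smooth_at_diff c x f : atlas c -> chart_dom c x -> smooth_at x f ->
  differentiable (f \o chart_inv c) (chart_fun c x).
Proof.
by move=> ac cx fx; apply/smooth_near_differentiable/smooth_at_chart.
Qed.

(** The tangent vector at [x] whose components in the chart [c] are [w]. *)
Definition chart_tangent c x (w : 'rV[R]_n) : (M -> R) -> R :=
  fun f => if `[< smooth_at x f >]
           then 'd (f \o chart_inv c) (chart_fun c x) w else 0.

Lemma chart_tangentE c x w f : smooth_at x f ->
  chart_tangent c x w f = 'd (f \o chart_inv c) (chart_fun c x) w.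
Proof. by move=> fx; rewrite /chart_tangent asboolT. Qed.

Lemma chart_tangent_tangent c x w : atlas c -> chart_dom c x ->
  tangent x (chart_tangent c x w).
Proof.
move=> ac cx; exists c, w; split=> // f; rewrite /chart_tangent.
by case: asboolP => // fx; rewrite deriveE //; apply: smooth_at_diff.
Qed.

(** A tangent vector is given with some chart; by the chain rule its components
    in another one are obtained by the differential of the transition map. *)
Lemma tangentP c x v : atlas c -> chart_dom c x -> tangent x v ->
  exists w, v = chart_tangent c x w.
Proof.
move=> ac cx [d [w [ad dx vE]]].
exists ('d (chart_fun c \o chart_inv d) (chart_fun d x) w).
apply/funext => f; rewrite vE /chart_tangent; case: asboolP => // fx.
have dT : differentiable (chart_fun c \o chart_inv d) (chart_fun d x).
  exact/smooth_near_differentiable/transition_smooth_near.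
have Tx : (chart_fun c \o chart_inv d) (chart_fun d x) = chart_fun c x.
  by rewrite /= chart_invK.
have dF : differentiable (f \o chart_inv c)
    ((chart_fun c \o chart_inv d) (chart_fun d x)).
  by rewrite Tx; apply: smooth_at_diff.
rewrite deriveE; last exact: smooth_at_diff.
have [_ dE] := near_eq_differentiable (near_transition f ad ac dx cx)
  (differentiable_comp dT dF).
apply: etrans (congr1 (fun h : 'rV[R]_n -> R => h w) dE) _.
apply: etrans (congr1 (fun h : 'rV[R]_n -> R => h w) (diff_comp dT dF)) _.
exact: (congr1 (fun u => 'd (f \o chart_inv c) u
  ('d (chart_fun c \o chart_inv d) (chart_fun d x) w)) Tx).
Qed.

Lemma chart_tangent_linear c x a u w :
  chart_tangent c x (a *: u + w) =
  a *: chart_tangent c x u + chart_tangent c x w.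
Proof.
apply/funext => f; rewrite /chart_tangent !fctE.
by case: asboolP => _; rewrite ?linearP // scaler0 addr0.
Qed.

Lemma tangent_lin x a u v : tangent x u -> tangent x v ->
  tangent x (a *: u + v).
Proof.
have [c ac cx] := atlas_cover x.
move=> /(tangentP ac cx)[wu ->] /(tangentP ac cx)[wv ->].
by rewrite -chart_tangent_linear; apply: chart_tangent_tangent.
Qed.

Lemma tangent0 x : tangent x 0.
Proof.
have [c ac cx] := atlas_cover x.
suff <- : chart_tangent c x 0 = 0 by exact: chart_tangent_tangent.
by apply/funext => f; rewrite /chart_tangent linear0; case: asboolP.
Qed.

(** The coordinate functions of the chart recover the components.  Together
    with [tangentP] this makes the tangent space at [x] a copy of R^n. *)
Lemma chart_tangent_inj c x : atlas c -> chart_dom c x ->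
  injective (chart_tangent c x).
Proof.
move=> ac cx u w uw; apply/rowP => i.
have [L [Lc Li]] := @coord_linear R n i.
have LE : \forall v \near chart_fun c x,
    L v = ((fun y => chart_fun c y 0 i) \o chart_inv c) v.
  apply: filterS (near_chart_img ac cx) => v cv /=.
  by have [_ ->] := chart_img_dom ac cv; rewrite Li.
have sL : smooth_at x (fun y => chart_fun c y 0 i).
  exists c; split => //; apply: eq_smooth_near LE _.
  exact/smooth_nearT/smooth_on_linear.
have dL := linear_differentiable (chart_fun c x) Lc.
have [_ dE] := near_eq_differentiable LE dL.
have H v : chart_tangent c x v (fun y => chart_fun c y 0 i) = v 0 i.
  rewrite chart_tangentE //.
  apply: etrans (congr1 (fun h : 'rV[R]_n -> R => h v) dE) _.
  rewrite -Li.
  exact: (congr1 (fun h : 'rV[R]_n -> R => h v) (diff_lin (chart_fun c x) Lc)).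
by rewrite -!H uw.
Qed.

Lemma smooth_at_lin x a f g : smooth_at x f -> smooth_at x g ->
  smooth_at x (fun y => a * f y + g y).
Proof.
have [c ac cx] := atlas_cover x.
move=> /(smooth_at_chart ac cx)[U [oU Ux] fU].
move=> /(smooth_at_chart ac cx)[B [oB Bx] gO].
exists c; split => //; exists (U `&` B); first by split=> //; apply: openI.
have oUO := openI oU oB.
move=> k; apply: (Ck_onD oUO (f := fun u => a * f (chart_inv c u))).
  apply: (Ck_on_scale oUO (a := fun=> a)); first exact: Ck_on_cst.
  by apply: Ck_on_sub (fU k) => y [].
by apply: Ck_on_sub (gO k) => y [].
Qed.

Lemma tangent_fun_lin x v a f g : tangent x v -> smooth_at x f ->
  smooth_at x g -> v (fun y => a * f y + g y) = a * v f + v g.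
Proof.
have [c ac cx] := atlas_cover x.
move=> /(tangentP ac cx)[w ->] fx gx.
rewrite !chart_tangentE //; last exact: smooth_at_lin.
have df := smooth_at_diff ac cx fx; have dg := smooth_at_diff ac cx gx.
have daf := differentiableZ a df.
have -> : (fun y => a * f y + g y) \o chart_inv c =
  a \*: (f \o chart_inv c) + (g \o chart_inv c) by [].
apply: etrans (congr1 (fun h : 'rV[R]_n -> R => h w) (diffD daf dg)) _.
exact: (congr1 (fun h : 'rV[R]_n -> R => h w + _) (diffZ a df)).
Qed.

Lemma tangent_cst x v (k : R) : tangent x v -> v (fun=> k) = 0.
Proof.
have [c ac cx] := atlas_cover x.
move=> /(tangentP ac cx)[w ->].
rewrite chart_tangentE.
  by rewrite [X in 'd X _](_ : _ = cst k) // diff_cst.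
exists c; split => //; apply: smooth_nearT => j; exact: Ck_on_cst.
Qed.

Lemma vector_field_lin a (X Y : M -> (M -> R) -> R) :
  vector_field X -> vector_field Y -> vector_field (a *: X + Y).
Proof.
move=> [tX sX] [tY sY]; split=> [x|x f fx].
  exact: (tangent_lin a (tX x) (tY x)).
exact: (smooth_at_lin a (sX x f fx) (sY x f fx)).
Qed.

End Charts.

(** * Left translations and left invariant fields *)

Section Translations.
Context {R : realType} {n : nat} {G : lieGroupType R n}.
Implicit Types (a x y : G) (f : G -> R) (v : (G -> R) -> R).

(** Joint smoothness of [(a, b) |-> F (a * b)], for a map [F] that is smooth
    near [x * y].  The target is a normed space so that the lemma serves both
    for real functions and for charts. *)
Lemma mul_smooth_near (W : normedModType R) (F : G -> W) x y :
  (forall d, atlas d -> chart_dom d (x * y)%g ->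
    smooth_near (chart_fun d (x * y)%g) (F \o chart_inv d)) ->
  exists c1 c2 : chart 'rV[R]_n G,
    [/\ atlas c1, atlas c2, chart_dom c1 x, chart_dom c2 y &
      smooth_near (chart_fun c1 x, chart_fun c2 y)
        (fun p => F (chart_inv c1 p.1 * chart_inv c2 p.2)%g)].
Proof.
move=> Fxy.
have [mc [_ [d [[c1 ac1 [c2 ac2 <-]] ad [/= c1x c2y] dxy S]]]] :=
  lie_mul_smooth (x, y).
exists c1, c2; split => //.
(* The middle factor [chart_inv d \o chart_fun d] cancels only where the
   product stays in the domain of [d]. *)
have near_d : \forall p \near (chart_fun c1 x, chart_fun c2 y),
    chart_dom d (chart_inv c1 p.1 * chart_inv c2 p.2)%g.
  pose i12 (p : 'rV[R]_n * 'rV[R]_n) := (chart_inv c1 p.1, chart_inv c2 p.2).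
  have ic : {for (chart_fun c1 x, chart_fun c2 y), continuous i12}.
    apply: cvg_pair.
      apply: (@continuous_comp _ _ _ fst); first exact: cvg_fst.
      exact: chart_inv_continuous.
    apply: (@continuous_comp _ _ _ snd); first exact: cvg_snd.
    exact: chart_inv_continuous.
  have E : i12 (chart_fun c1 x, chart_fun c2 y) = (x, y).
    by rewrite /i12 /= !chart_invK.
  have mc' : {for i12 (chart_fun c1 x, chart_fun c2 y),
      continuous (fun q : G * G => (q.1 * q.2)%g)} by rewrite E.
  have := continuous_comp ic mc'; apply; rewrite /= !chart_invK //.
  exact: near_chart_dom.
apply: (@eq_smooth_near _ _ _ _ ((F \o chart_inv d) \o
   (chart_fun d \o (fun q : G * G => (q.1 * q.2)%g) \o
     chart_inv (prod_chart c1 c2)))).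
  by apply: filterS near_d => p dp /=; rewrite chart_invK.
apply: smooth_near_comp => //; first exact: finite_coords_rV.
by rewrite /= !chart_invK //; apply: Fxy.
Qed.

Lemma translate_smooth_near (W : normedModType R) (F : G -> W) c a x :
  (forall d, atlas d -> chart_dom d (a * x)%g ->
    smooth_near (chart_fun d (a * x)%g) (F \o chart_inv d)) ->
  atlas c -> chart_dom c x ->
  smooth_near (chart_fun c x) ((fun y => F (a * y)%g) \o chart_inv c).
Proof.
move=> /mul_smooth_near[c1 [c2 [ac1 ac2 c1a c2x S]]] ac cx.
apply: (smooth_near_change (d := c2)) => //.
pose h (p : 'rV[R]_n * 'rV[R]_n) := F (chart_inv c1 p.1 * chart_inv c2 p.2)%g.
have -> : (fun y => F (a * y)%g) \o chart_inv c2 =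
    h \o (fun u => (chart_fun c1 a, u)).
  by apply/funext => u; rewrite /h /= chart_invK.
apply: smooth_near_comp => //.
  exact: finite_coords_prod (finite_coords_rV _) (finite_coords_rV _).
exact/smooth_nearT/smooth_on_pairr.
Qed.

Lemma smooth_at_translate a x f : smooth_at (a * x)%g f ->
  smooth_at x (fun y => f (a * y)%g).
Proof.
have [c ac cx] := atlas_cover x; move=> fax; exists c; split => //.
by apply: translate_smooth_near => // d ad dx; apply: smooth_at_chart.
Qed.

(** Tangent vectors vanish on functions that are not smooth at their base point,
    so both directions are needed to compare a tangent vector with its
    translate. *)
Lemma smooth_at_translateE a x f :
  smooth_at x (fun y => f (a * y)%g) <-> smooth_at (a * x)%g f.
Proof.
split; last exact: smooth_at_translate.
rewrite -{1}(mulKg a x) => /smooth_at_translate.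
by rewrite (_ : (fun y => _) = f) //; apply/funext => y; rewrite mulVKg.
Qed.

Lemma left_diff_tangent a x v : tangent x v ->
  tangent (a * x)%g (left_diff a v).
Proof.
have [c ac cx] := atlas_cover x; have [d ad dx] := atlas_cover (a * x)%g.
move=> /(tangentP ac cx)[w ->].
pose t := (fun y => chart_fun d (a * y)%g) \o chart_inv c.
have dt : differentiable t (chart_fun c x).
  apply/smooth_near_differentiable/translate_smooth_near => // e ae ex.
  exact: transition_smooth_near.
have -> : left_diff a (chart_tangent c x w) =
    chart_tangent d (a * x)%g ('d t (chart_fun c x) w); last first.
  exact: chart_tangent_tangent.
apply/funext => f; rewrite /left_diff.
have [fax|nf] := pselect (smooth_at (a * x)%g f); last first.
  by rewrite /chart_tangent !asboolF // smooth_at_translateE.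
rewrite !chart_tangentE //; last exact: smooth_at_translate.
have tx : t (chart_fun c x) = chart_fun d (a * x)%g by rewrite /t /= chart_invK.
have df : differentiable (f \o chart_inv d) (t (chart_fun c x)).
  by rewrite tx; apply: smooth_at_diff.
have ax : \forall y \near x, chart_dom d (a * y)%g.
  have : {for chart_inv c (chart_fun c x), continuous (fun y : G => (a * y)%g)}.
    rewrite chart_invK //.
    have [mc _] := lie_mul_smooth (a, x).
    apply: (@continuous_comp _ _ _ (fun y => (a, y))
      (fun q : G * G => (q.1 * q.2)%g)) => //.
    by apply: cvg_pair; [exact: cvg_cst|exact: cvg_id].
  by rewrite chart_invK //; apply; apply: near_chart_dom.
have E : \forall u \near chart_fun c x,
    ((f \o chart_inv d) \o t) u = ((fun y => f (a * y)%g) \o chart_inv c) u.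
  by apply: filterS (near_chart_inv ac cx ax) => u du; rewrite /t /= chart_invK.
have [_ dE] := near_eq_differentiable E (differentiable_comp dt df).
apply: etrans (congr1 (fun h : 'rV[R]_n -> R => h w) dE) _.
apply: etrans (congr1 (fun h : 'rV[R]_n -> R => h w) (diff_comp dt df)) _.
exact: (congr1 (fun u => 'd (f \o chart_inv d) u ('d t (chart_fun c x) w)) tx).
Qed.

Lemma left_diffM a b v : left_diff (a * b)%g v = left_diff a (left_diff b v).
Proof. by apply/funext => f; congr (v _); apply/funext => y; rewrite mulgA. Qed.

Lemma left_diff1 v : left_diff 1%g v = v.
Proof. by apply/funext => f; congr (v _); apply/funext => y; rewrite mul1g. Qed.

Definition left_field v : G -> (G -> R) -> R := fun x => left_diff x v.

(** For [f] smooth near [x], put [h (s, u) = f (s * u)] in charts; this is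
    smooth jointly in both variables near the pair [(x, 1)].  The field applied
    to [f] is the partial derivative of [h] in the second variable at the
    identity, which is smooth in the first variable.  Smoothness of each
    single translation would not suffice. *)
Lemma left_field_vector_field v : tangent 1%g v -> vector_field (left_field v).
Proof.
move=> tv; split=> [x|x f fx].
  by rewrite -{1}(mulg1 x); apply: left_diff_tangent.
have [|c1 [c2 [ac1 ac2 c1x c21 [U [oU Ux] hU]]]] := @mul_smooth_near R f x 1%g.
  by move=> d ad; rewrite mulg1 => dx; apply: smooth_at_chart.
exists c1; split => //.
have [w vE] := tangentP ac2 c21 tv.
set e2 := chart_fun c2 1%g in Ux *.
pose h (p : 'rV[R]_n * 'rV[R]_n) := f (chart_inv c1 p.1 * chart_inv c2 p.2)%g.
pose i1 (s : 'rV[R]_n) := (s, e2).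
have i1c s : {for s, continuous i1}.
  exact: (@smooth_on_pairl _ 'rV[R]_n _ e2 0%N s I).
have oV : open (i1 @^-1` U).
  by rewrite -[X in open X]setTI; apply: open_setI_preimage openT _ oU.
exists (i1 @^-1` U); first by [].
move=> k.
have S : Ck_on k (i1 @^-1` U) ((fun p => 'd h p (0, w)) \o i1).
  apply: (Ck_on_comp (O := U)) => //.
  - exact: finite_coords_prod (finite_coords_rV _) (finite_coords_rV _).
  - exact: Ck_on_sub (@subsetT _ _) (@smooth_on_pairl _ 'rV[R]_n _ e2 k).
  - by have [_] := hU k.+1; apply.
apply: eq_Ck_on S => // s Us; rewrite /left_field /left_diff /= vE.
pose i2 (u : 'rV[R]_n) := (s, u).
have hs : smooth_near e2 (h \o i2).
  apply: smooth_near_comp.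
  - exact: finite_coords_prod (finite_coords_rV _) (finite_coords_rV _).
  - exact/smooth_nearT/smooth_on_pairr.
  - by exists U.
rewrite chart_tangentE; last by exists c2; split.
have dh : differentiable h (i2 e2) by have [+ _] := hU 1%N; apply.
have di2 : differentiable i2 e2.
  by apply: differentiable_pair; [apply: differentiable_cst|apply: ex_diff].
apply/esym/(etrans (congr1 (fun g : 'rV[R]_n -> R => g w) (diff_comp di2 dh))).
congr ('d h (s, e2) _).
have ds : differentiable (cst s : 'rV[R]_n -> 'rV[R]_n) e2.
  exact: differentiable_cst.
have di : differentiable (id : 'rV[R]_n -> 'rV[R]_n) e2 by apply: ex_diff.
apply: etrans (congr1 (fun g : 'rV[R]_n -> _ => g w) (diff_pair ds di)) _.
apply/pair_equal_spec; split.
  exact: (congr1 (fun g : 'rV[R]_n -> _ => g w) (diff_cst s e2)).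
exact: (congr1 (fun g : 'rV[R]_n -> _ => g w)
  (diff_val (is_diff_def := is_diff_id e2))).
Qed.

Lemma left_field_lie_algebra v : tangent 1%g v -> lie_algebra G (left_field v).
Proof.
move=> tv; split; first exact: left_field_vector_field.
by move=> a x; apply: left_diffM.
Qed.

Lemma lie_algebraE X : lie_algebra G X -> X = left_field (X 1%g).
Proof. by move=> [_ LX]; apply/funext => x; rewrite -[in LHS](mulg1 x) LX. Qed.

Lemma lie_algebra_tangent X x : lie_algebra G X -> tangent x (X x).
Proof. by move=> [[]]. Qed.

Lemma lie_algebra_lin (k : R) X Y : lie_algebra G X -> lie_algebra G Y ->
  lie_algebra G (k *: X + Y).
Proof.
move=> [vX LX] [vY LY]; split; first exact: vector_field_lin.
by move=> a x; rewrite !fctE LX LY.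
Qed.

Lemma lie_algebra0 : lie_algebra G 0.
Proof.
split=> [|a x //]; split=> [x|x f fx]; first exact: tangent0.
have [c ac cx] := atlas_cover x; exists c; split => //.
by apply: smooth_nearT => k; apply: Ck_on_cst.
Qed.

Lemma lie_algebra_eq0 X : lie_algebra G X -> X 1%g = 0 -> X = 0.
Proof. by move=> LX X1; rewrite (lie_algebraE LX) X1. Qed.

(** Evaluation at the identity is an isomorphism from the Lie algebra to the
    tangent space there, so the Lie algebra has the dimension of the group. *)
Lemma lie_algebra_coordinates :
  exists E : 'rV[R]_n -> G -> (G -> R) -> R,
    [/\ forall w, lie_algebra G (E w),
        forall k u w, E (k *: u + w) = k *: E u + E w,
        forall Z, lie_algebra G Z -> exists w, Z = E w &
        forall w, E w = 0 -> w = 0].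
Proof.
have [c ac c1] := atlas_cover (1%g : G).
exists (fun w => left_field (chart_tangent c 1%g w)); split.
- by move=> w; apply/left_field_lie_algebra/chart_tangent_tangent.
- by move=> k u w; rewrite chart_tangent_linear.
- move=> Z LZ; have [w wE] := tangentP ac c1 (lie_algebra_tangent 1%g LZ).
  by exists w; rewrite -wE -lie_algebraE.
- move=> w Ew0; apply: (chart_tangent_inj ac c1).
  have := congr1 (fun Z => Z 1%g) Ew0; rewrite /left_field left_diff1 => ->.
  by apply/funext => f; rewrite /chart_tangent linear0; case: asboolP.
Qed.

End Translations.

(** * Skew forms in odd dimension *)

(** The Gram matrix satisfies [A^T = - A], so [\det A = (-1) ^ n * \det A = 0],
    and a nonzero row vector killed by [A] is in the radical. *)
Lemma odd_skew_degenerate (R : realType) n (B : 'rV[R]_n -> 'rV[R]_n -> R) :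
  odd n ->
  (forall a u v w, B (a *: u + v) w = a * B u w + B v w) ->
  (forall u v, B u v = - B v u) ->
  exists2 v, v != 0 & forall w, B v w = 0.
Proof.
move=> on Bl Bs.
have B0 w : B 0 w = 0.
  have := Bl 1 0 0 w; rewrite scaler0 addr0 mul1r => /eqP.
  by rewrite -subr_eq subrr eq_sym => /eqP.
have Bsum (I : finType) (c : I -> R) (e : I -> 'rV[R]_n) w :
    B (\sum_i c i *: e i) w = \sum_i c i * B (e i) w.
  by elim/big_rec2: _ => [//|i y x _ <-]; rewrite Bl.
pose A := \matrix_(i, j) B (delta_mx 0 i) (delta_mx 0 j).
have AT : A^T = - A by apply/matrixP => i j; rewrite !mxE Bs.
have /det0P[v v0 vA] : \det A == 0.
  have : \det A = - \det A.
    by rewrite -[LHS]det_tr AT -scaleN1r detZ -signr_odd on expr1 mulN1r.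
  by move/eqP; rewrite -addr_eq0 -mulr2n mulrn_eq0.
exists v => // w; rewrite (row_sum_delta v) Bsum.
under eq_bigr => i _ do rewrite Bs {1}(row_sum_delta w) Bsum -sumrN mulr_sumr.
rewrite exchange_big big1 //= => j _.
have := congr1 (fun u : 'rV[R]_n => u 0 j) vA; rewrite !mxE => vAj.
transitivity (w 0 j * \sum_i v 0 i * A i j); last by rewrite vAj mulr0.
rewrite mulr_sumr; apply: eq_bigr => i _.
by rewrite mxE -mulrN -Bs mulrCA.
Qed.

(** * The Lie bracket *)

Section Bracket.
Context {R : realType} {n : nat} {G : lieGroupType R n}.
Implicit Types (X Y Z : G -> (G -> R) -> R).

Lemma lie_bracketC X Y : lie_bracket X Y = - lie_bracket Y X.
Proof.
apply/funext => x; apply/funext => f; rewrite !fctE /lie_bracket.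
by case: asboolP => _; rewrite ?oppr0 ?opprB.
Qed.

Lemma lie_bracket_linr (k : R) X Y Z : vector_field X -> vector_field Y ->
  vector_field Z ->
  lie_bracket X (k *: Y + Z) = k *: lie_bracket X Y + lie_bracket X Z.
Proof.
move=> [tX sX] [tY sY] [tZ sZ]; apply/funext => x; apply/funext => f.
rewrite !fctE /lie_bracket; case: asboolP => fx; last by rewrite scaler0 addr0.
have -> : X x (fun y => (k *: Y + Z) y f) = k * X x (Y ^~ f) + X x (Z ^~ f).
  exact: tangent_fun_lin (tX x) (sY _ _ fx) (sZ _ _ fx).
have E (p q r s : R) : k * p + q - (k * r + s) = k * (p - r) + (q - s) by ring.
exact: E.
Qed.

Lemma lie_bracket_linl (k : R) X Y Z : vector_field X -> vector_field Y ->
  vector_field Z ->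
  lie_bracket (k *: X + Y) Z = k *: lie_bracket X Z + lie_bracket Y Z.
Proof.
move=> vX vY vZ; rewrite lie_bracketC lie_bracket_linr // opprD -scalerN.
by rewrite -!lie_bracketC.
Qed.

Lemma lie_bracket_translate X Y a x : lie_algebra G X -> lie_algebra G Y ->
  lie_bracket X Y (a * x)%g = left_diff a (lie_bracket X Y x).
Proof.
move=> [_ LX] [_ LY]; apply/funext => f; rewrite /left_diff /lie_bracket LX LY.
rewrite (propext (smooth_at_translateE a x f)); case: asboolP => // _.
rewrite /left_diff.
have E Z (LZ : forall a x : G, Z (a * x)%g = left_diff a (Z x)) :
    (fun y => Z (a * y)%g f) = (fun y => Z y (fun z => f (a * z)%g)).
  by apply/funext => y; rewrite LZ.
by rewrite !E.
Qed.

End Bracket.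

(** * Left invariant metrics and parallel fields *)

Section LeftInvariantMetric.
Context {R : realType} {n : nat} {G : lieGroupType R n}.
Context (g : G -> ((G -> R) -> R) -> ((G -> R) -> R) -> R).
Context (g_metric : riemannian_metric g) (g_left : left_invariant_metric g).
Implicit Types (X Y Z : G -> (G -> R) -> R).

Definition inner X Y : R := g 1%g (X 1%g) (Y 1%g).

Lemma metric0l x w : tangent x w -> g x 0 w = 0.
Proof.
move=> tw; have := metric_linear g_metric 1 (tangent0 x) (tangent0 x) tw.
by rewrite scaler0 addr0 mul1r => /eqP; rewrite -subr_eq subrr eq_sym => /eqP.
Qed.

Lemma metric_inner X Y x : lie_algebra G X -> lie_algebra G Y ->
  g x (X x) (Y x) = inner X Y.
Proof.
move=> LX LY; rewrite (lie_algebraE LX) (lie_algebraE LY) /inner /left_field.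
rewrite !left_diff1 -[in LHS](mulg1 x) !left_diffM.
by rewrite !left_diff1 g_left //; apply: lie_algebra_tangent.
Qed.

Lemma inner_linl (k : R) X Y Z : lie_algebra G X -> lie_algebra G Y ->
  lie_algebra G Z -> inner (k *: X + Y) Z = k * inner X Z + inner Y Z.
Proof.
by move=> ? ? ?; apply: (metric_linear g_metric); apply: lie_algebra_tangent.
Qed.

Lemma inner0l X : lie_algebra G X -> inner 0 X = 0.
Proof. by move=> LX; apply/metric0l/lie_algebra_tangent. Qed.

Lemma innerZl (k : R) X Y : lie_algebra G X -> lie_algebra G Y ->
  inner (k *: X) Y = k * inner X Y.
Proof.
move=> LX LY; rewrite -[k *: X]addr0 inner_linl ?inner0l ?addr0 //.
exact: lie_algebra0.
Qed.

Lemma innerC X Y : lie_algebra G X -> lie_algebra G Y -> inner X Y = inner Y X.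
Proof.
by move=> ? ?; apply: (Defs.metric_sym g_metric); apply: lie_algebra_tangent.
Qed.

Lemma inner_eq0 X : lie_algebra G X -> inner X X = 0 -> X = 0.
Proof.
move=> LX X0; apply: lie_algebra_eq0 => //; apply: contrapT => X1.
have := metric_pos g_metric (lie_algebra_tangent 1%g LX) X1.
by rewrite -/(inner X X) X0 ltxx.
Qed.

Lemma metric_nondegenerate x u v : tangent x u -> tangent x v ->
  (forall w, tangent x w -> g x u w = g x v w) -> u = v.
Proof.
move=> tu tv uv.
have tD : tangent x (-1 *: v + u) by exact: (tangent_lin (-1) tv tu).
apply: contrapT => uv_neq; have D0 : -1 *: v + u <> 0.
  by rewrite scaleN1r addrC => /eqP; rewrite subr_eq0 => /eqP.
have := metric_pos g_metric tD D0.
by rewrite (metric_linear g_metric (-1) tv tu tD) (uv _ tD) mulN1r addNr ltxx.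
Qed.

Section LeviCivita.
Context (nabla : (G -> (G -> R) -> R) -> (G -> (G -> R) -> R) ->
  G -> (G -> R) -> R).
Context (LC : levi_civita g nabla).

(** That the bracket is again tangent at each point normally comes from the
    symmetry of second derivatives.  A torsion-free connection gives it at once,
    by exhibiting the bracket as a difference of two vector fields. *)
Lemma lie_algebra_bracket X Y : lie_algebra G X -> lie_algebra G Y ->
  lie_algebra G (lie_bracket X Y).
Proof.
move=> LX LY; split; last by move=> a x; apply: lie_bracket_translate.
rewrite -(connection_torsion_free LC LX.1 LY.1).
have -> : nabla X Y - nabla Y X = (-1) *: nabla Y X + nabla X Y.
  by rewrite scaleN1r addrC.
exact: vector_field_lin (connection_field LC LY.1 LX.1)
  (connection_field LC LX.1 LY.1).
Qed.

(** [g(Y, Z)] is constant for left invariant fields, hence its derivative along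
    [X] is zero. *)
Lemma connection_skew X Y Z :
  lie_algebra G X -> lie_algebra G Y -> lie_algebra G Z ->
  inner (nabla X Y) Z + inner Y (nabla X Z) = 0.
Proof.
move=> LX LY LZ.
rewrite /inner -(connection_metric LC LX.1 LY.1 LZ.1 1%g).
have -> : (fun y => g y (Y y) (Z y)) = fun=> inner Y Z.
  by apply/funext => y; apply: metric_inner.
exact/tangent_cst/lie_algebra_tangent.
Qed.

Context (X : G -> (G -> R) -> R) (LX : lie_algebra G X).
Context (X_parallel : forall Y, vector_field Y -> nabla Y X = 0).

(** Skew-adjointness of [nabla_Y] and [nabla_Y X = 0] make [nabla_Y Z]
    orthogonal to [X], and the bracket is [nabla_Y Z - nabla_Z Y]. *)
Lemma parallel_bracket_orthogonal Y Z : lie_algebra G Y -> lie_algebra G Z ->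
  inner X (lie_bracket Y Z) = 0.
Proof.
move=> LY LZ; rewrite innerC //; last exact: lie_algebra_bracket.
have H U V : lie_algebra G U -> lie_algebra G V -> inner (nabla U V) X = 0.
  move=> LU LV; have := connection_skew LU LV LX.
  rewrite (X_parallel LU.1).
  suff -> : inner V 0 = 0 by rewrite addr0.
  by rewrite innerC ?inner0l //; apply: lie_algebra0.
rewrite -(connection_torsion_free LC LY.1 LZ.1).
have -> : nabla Y Z - nabla Z Y = (-1) *: nabla Z Y + nabla Y Z.
  by rewrite scaleN1r addrC.
have t U V : lie_algebra G U -> lie_algebra G V -> tangent 1%g (nabla U V 1%g).
  by move=> LU LV; have [] := connection_field LC LU.1 LV.1.
apply: etrans (metric_linear g_metric (-1) (t _ _ LZ LY) (t _ _ LY LZ)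
  (lie_algebra_tangent 1%g LX)) _.
by rewrite -/(inner (nabla Z Y) X) -/(inner (nabla Y Z) X) !H // mulr0 addr0.
Qed.

(** Here [nabla_X Z = [X, Z]] because [nabla_Z X = 0].  Skew-adjointness applied
    to [Y] and [[X, Y]] reads [|[X, Y]|^2 + <Y, [X, [X, Y]]> = 0]. *)
Lemma parallel_central :
  (forall U Y Z, lie_algebra G U -> lie_algebra G Y -> lie_algebra G Z ->
     lie_bracket U (lie_bracket Y Z) = 0) ->
  lie_center G X.
Proof.
move=> two_step; split=> // Y LY.
have LXY := lie_algebra_bracket LX LY.
have nX Z : lie_algebra G Z -> nabla X Z = lie_bracket X Z.
  move=> LZ; rewrite -(connection_torsion_free LC LX.1 LZ.1).
  by rewrite (X_parallel LZ.1) subr0.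
apply: inner_eq0 => //; have := connection_skew LX LY LXY.
rewrite !nX // two_step //.
suff -> : inner Y 0 = 0 by rewrite addr0.
by rewrite innerC ?inner0l //; apply: lie_algebra0.
Qed.

End LeviCivita.

(** The term [sqrt (g(Y, Y))] is left invariant by itself, so the term [g(X, Y)]
    is too; as [g] is nondegenerate this determines [X] from its value at the
    identity. *)
Lemma left_invariant_randers_field X : vector_field X ->
  left_invariant_finsler (randers g X) -> lie_algebra G X.
Proof.
move=> vX lF; have [tX _] := vX.
have XE a : X a = left_diff a (X 1%g).
  have tX' : tangent a (left_diff a (X 1%g)).
    by rewrite -[X in tangent X](mulg1 a); apply: left_diff_tangent.
  have gE u v : tangent 1%g u -> tangent 1%g v ->
      g a (left_diff a u) (left_diff a v) = g 1%g u v.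
    by move=> tu tv; have := g_left a tu tv; rewrite mulg1.
  have E u : tangent a u -> g a (X a) u = g a (left_diff a (X 1%g)) u.
    move=> tu; have tu' : tangent 1%g (left_diff a^-1%g u).
      by rewrite -(mulVg a); apply: left_diff_tangent.
    have uE : left_diff a (left_diff a^-1%g u) = u.
      by rewrite -left_diffM mulgV left_diff1.
    have := lF a u tu; rewrite /randers -(gE _ _ tu' tu') uE => /addrI ->.
    by rewrite -gE // uE.
  exact: (metric_nondegenerate (tX a) tX' E).
split=> // a x; by rewrite XE left_diffM -XE.
Qed.

End LeftInvariantMetric.

(** * The bracket form on a Lie algebra with two-dimensional center *)

Section PlaneCenter.
Context {R : realType} {n : nat} {G : lieGroupType R n}.
Context (g : G -> ((G -> R) -> R) -> ((G -> R) -> R) -> R).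
Context (g_metric : riemannian_metric g).
Implicit Types (X Y Z U W : G -> (G -> R) -> R).

(** To be used with an orthogonal basis [X], [W] of the center.  The radical of
    the first term [<[Y, Z], W>] contains the center, on which the other two
    terms [<Y, X><Z, W> - <Y, W><Z, X>] are nondegenerate. *)
Definition bracket_form X W Y Z : R := inner g (lie_bracket Y Z) W
  + inner g Y X * inner g Z W - inner g Y W * inner g Z X.

Lemma bracket_form_linl X W a U Y Z :
  lie_algebra G X -> lie_algebra G W ->
  lie_algebra G U -> lie_algebra G Y -> lie_algebra G Z ->
  lie_algebra G (lie_bracket U Z) -> lie_algebra G (lie_bracket Y Z) ->
  bracket_form X W (a *: U + Y) Z =
  a * bracket_form X W U Z + bracket_form X W Y Z.
Proof.
move=> LX LW LU LY LZ LUZ LYZ; rewrite /bracket_form.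
rewrite (lie_bracket_linl a LU.1 LY.1 LZ.1).
rewrite (inner_linl g_metric a LUZ LYZ LW).
rewrite (inner_linl g_metric a LU LY LX) (inner_linl g_metric a LU LY LW).
ring.
Qed.

Lemma bracket_formC X W Y Z :
  lie_algebra G W -> lie_algebra G (lie_bracket Z Y) ->
  bracket_form X W Y Z = - bracket_form X W Z Y.
Proof.
move=> LW LZY; rewrite /bracket_form lie_bracketC -scaleN1r.
rewrite (innerZl g_metric (-1) LZY LW).
ring.
Qed.

(** With [p = <X, b0>] and [q = <X, b1>] for a basis [b] of the center, the
    vector [W = q b0 - p b1] is orthogonal to [X]; it is nonzero since
    [p = q = 0] would make the central vector [X] orthogonal to itself. *)
Lemma orthogonal_in_center X : has_dimension (lie_center G) 2 ->
  lie_center G X -> X <> 0 ->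
  exists W, [/\ lie_center G W, inner g X W = 0, inner g W W != 0 &
    forall U, lie_center G U -> inner g X U = 0 -> inner g U W = 0 -> U = 0].
Proof.
move=> [b [bS bfree]] CX X0.
have Cb i : lie_center G (b i).
  apply/bS; exists (fun j => (j == i)%:R).
  rewrite (bigD1 i) //= eqxx scale1r big1 ?addr0 // => j /negPf ->.
  by rewrite scale0r.
have LX := CX.1.
have Lb i := (Cb i).1.
pose i0 : 'I_2 := ord0; pose i1 : 'I_2 := ord_max.
have span U : lie_center G U -> exists c : R * R, U = c.1 *: b i0 + c.2 *: b i1.
  move=> /bS[c ->]; exists (c i0, c i1); rewrite big_ord_recl big_ord1 /=.
  by congr (_ + c _ *: b _); apply: val_inj.
pose p := inner g X (b i0); pose q := inner g X (b i1).
pose W := q *: b i0 + (- p) *: b i1.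
have linr k l Y : lie_algebra G Y ->
    inner g Y (k *: b i0 + l *: b i1) =
    k * inner g Y (b i0) + l * inner g Y (b i1).
  move=> LY; have Lb1 : lie_algebra G (l *: b i1).
    rewrite -[l *: _]addr0; apply: lie_algebra_lin => //.
    exact: lie_algebra0.
  rewrite innerC //; last exact: lie_algebra_lin.
  by rewrite inner_linl // innerZl // !(innerC g_metric (Lb _) LY).
have CW : lie_center G W.
  apply/bS; exists (fun i => if i == i0 then q else - p).
  by rewrite big_ord_recl big_ord1 /=; congr (_ + _ *: b _); apply: val_inj.
have XW : inner g X W = 0 by rewrite linr // -/p -/q; ring.
have pq : ~ (p = 0 /\ q = 0).
  move=> [p0 q0]; apply: X0; apply: (inner_eq0 g_metric LX).
  have [[k' l'] /= XE] := span X CX.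
  by rewrite {2}XE linr // -/p -/q p0 q0 !mulr0 addr0.
have key U : lie_center G U -> inner g X U = 0 -> inner g U W = 0 -> U = 0.
  move=> CU; have [[k l] /= UE] := span U CU.
  rewrite {1}UE linr // -/p -/q => XU UW.
  have LU := CU.1.
  (* [U] is orthogonal to [X], so both [p *: U] and [q *: U] are multiples of
     [W]; one of [p] and [q] is invertible. *)
  have pU : p *: U = (- l) *: W.
    rewrite UE /W !scalerDr !scalerA; congr (_ *: _ + _ *: _); last by ring.
    by move/eqP: XU; rewrite addr_eq0 => /eqP; rewrite mulrC => ->; ring.
  have qU : q *: U = k *: W.
    rewrite UE /W !scalerDr !scalerA; congr (_ *: _ + _ *: _); first by ring.
    by move/eqP: XU; rewrite addrC addr_eq0 => /eqP; rewrite mulrC => ->; ring.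
  have UU r s : r *: U = s *: W -> r <> 0 -> U = 0.
    move=> rs r0; apply: (inner_eq0 g_metric LU); apply/eqP.
    have : r * inner g U U = 0.
      rewrite -innerZl // rs innerZl //; last exact: CW.1.
      by rewrite innerC ?UW ?mulr0 //; exact: CW.1.
    by move/eqP; rewrite mulf_eq0 => /orP[/eqP //|].
  have [p0|/eqP p0] := eqVneq p 0; last exact: UU pU p0.
  by apply: UU qU _ => q0; apply: pq.
exists W; split => //; apply/eqP => WW.
have W0 : W = 0 by apply: (inner_eq0 g_metric CW.1).
have := bfree (fun i => if i == i0 then q else - p).
have -> : \sum_(i < 2) (if i == i0 then q else - p) *: b i = W.
  by rewrite big_ord_recl big_ord1 /=; congr (_ + _ *: b _); apply: val_inj.
move=> /(_ W0) c0.
apply: pq; split; last by have := c0 i0; rewrite eqxx.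
by have /eqP := c0 i1; rewrite oppr_eq0 => /eqP.
Qed.

End PlaneCenter.

Theorem proposition4p1 (R : realType) (N : lieGroupType R 5)
    (N_simply_connected : simply_connected R N)
    (N_two_step : two_step_nilpotent N)
    (N_center : has_dimension (lie_center N) 2) :
  ~ exists (g : N -> ((N -> R) -> R) -> ((N -> R) -> R) -> R)
           (X : N -> (N -> R) -> R),
      [/\ riemannian_metric g /\ left_invariant_metric g,
          vector_field X /\ X <> 0,
          forall x, Num.sqrt (g x (X x) (X x)) < 1,
          left_invariant_finsler (randers g X) &
          randers_berwald g X].
Proof.
move=> [g [X [[gm gl] [vX X0] _ lF [nabla LC Xpar]]]].
have LX := left_invariant_randers_field gm gl vX lF.
have CX : lie_center N X := parallel_central gm gl LC LX Xpar N_two_step.2.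
have [W [CW XW WW key]] := orthogonal_in_center gm N_center CX X0.
have LW := CW.1.
have [E [LE Elin Esurj Einj]] := @lie_algebra_coordinates R 5 N.
have LB Y Z : lie_algebra N Y -> lie_algebra N Z ->
    lie_algebra N (lie_bracket Y Z).
  exact: (lie_algebra_bracket LC).
pose B u v := bracket_form g X W (E u) (E v).
have Bl a u v w : B (a *: u + v) w = a * B u w + B v w.
  by rewrite /B Elin (bracket_form_linl gm) //; apply: LB; apply: LE.
have Bs u v : B u v = - B v u.
  by apply: (bracket_formC gm) => //; apply: LB; apply: LE.
have [v v0 Bv] := odd_skew_degenerate (isT : odd 5) Bl Bs.
set V := E v; have LV : lie_algebra N V by exact: LE.
have BV Z : lie_algebra N Z -> inner g (lie_bracket V Z) W
    + inner g V X * inner g Z W - inner g V W * inner g Z X = 0.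
  by move=> /Esurj[w ->]; apply: Bv.
have central0 Z : lie_center N Z -> inner g (lie_bracket V Z) W = 0.
  by move=> [_ CZ]; rewrite lie_bracketC CZ // oppr0 inner0l.
(* Evaluation at the central fields [W] and [X], where the bracket term
   vanishes. *)
have VX : inner g V X = 0.
  have := BV W LW; rewrite central0 // (innerC gm LW LX) XW mulr0 subr0 add0r.
  by move/eqP; rewrite mulf_eq0 (negPf WW) orbF => /eqP.
have VW : inner g V W = 0.
  have := BV X LX; rewrite central0 // VX mul0r !add0r => /eqP.
  rewrite oppr_eq0 mulf_eq0 => /orP[/eqP//|/eqP XX].
  by case: X0; apply: inner_eq0 XX.
suff CV : lie_center N V.
  by move/eqP: v0; apply; apply: Einj; apply: key => //; rewrite innerC.
split=> // Z LZ; apply: key.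
- split=> [|U LU]; first exact: LB.
  by rewrite lie_bracketC N_two_step.2 // oppr0.
- exact: (parallel_bracket_orthogonal gm gl LC LX Xpar).
- by have := BV Z LZ; rewrite VX VW !mul0r addr0 subr0.
Qed.
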